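(* Let $\boldsymbol{\alpha}^\perp\in C^2(\mathbb{R},\mathbb{R}^2)$ with $\boldsymbol{\alpha}^\perp(\xi)=0$ for $\xi\le0$, let $n_0\ge0$, and let $\boldsymbol{u}_e^{\perp(0)},\gamma_e^{(0)},\boldsymbol{\beta}_e^{\perp(0)},\boldsymbol{Y}_e^\perp,Y_e^3$ and $n_e^{(0)}$ be defined as in the context. For $x=(x^0,z)$ with $x^0\ge0$, put $\xi:=x^0-z$, $\xi_-:=x^0+z$, assume $\xi_-\ge0$, and define the first corrected approximation $\boldsymbol{u}_e^{\perp(1)}$ by $$\boldsymbol{u}_e^{\perp(1)}(x^0,z)-\boldsymbol{u}_e^{\perp(0)}(x^0-z)=-\frac{2\pi e^2}{m_ec^2}\int_{D_x}n_e^{(0)}(x^{0\prime},z')\,\boldsymbol{\beta}_e^{\perp(0)}(x^{0\prime}-z')\,dx^{0\prime}dz',$$ where $D_x:=\{(x^{0\prime},z')\;|\;0\le x^{0\prime}\le x^0,\ |z-z'|\le x^0-x^{0\prime}\}$. Then $$\boldsymbol{u}_e^{\perp(1)}-\boldsymbol{u}_e^{\perp(0)}=-2K\,\boldsymbol{W}_e^\perp,\qquad K:=\frac{\pi e^2n_0}{m_ec^2},\qquad \boldsymbol{W}_e^\perp(x):=\frac12\int_0^{\xi_-}\boldsymbol{Y}_e^\perp\big[\hat\xi(\xi,\xi_-')\big]\,d\xi_-' ,$$ where $\hat\xi(\xi,\xi_-'):=\min\{\xi,\ \underline{x^0}(\xi_-')-\underline z(\xi_-')\}$ and $(\underline{x^0}(\xi_-'),\underline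 z(\xi_-'))$ is the intersection in the $(x^0,z)$-plane of the line $x^0+z=\xi_-'$ with the trajectory $\{(x^0,z_e^{(0)}(x^0,0)) : x^0\ge 0\}$.
   Context: Let $m_e>0$ and $-e$ be the electron mass and charge, $c>0$ the speed of light, $x^0=ct$. For $\xi\in\mathbb{R}$: $$\boldsymbol{u}_e^{\perp(0)}(\xi):=\frac{e}{m_ec^2}\boldsymbol{\alpha}^\perp(\xi),\quad u_e^{z(0)}:=\tfrac12|\boldsymbol{u}_e^{\perp(0)}|^2,\quad \gamma_e^{(0)}:=1+u_e^{z(0)},\quad \boldsymbol{\beta}_e^{\perp(0)}:=\boldsymbol{u}_e^{\perp(0)}/\gamma_e^{(0)},$$ $$\boldsymbol{Y}_e^\perp(\xi):=\int_0^\xi\boldsymbol{u}_e^{\perp(0)}(\xi')d\xi',\quad Y_e^3(\xi):=\int_0^\xi u_e^{z(0)}(\xi')d\xi',\quad \Xi_e(\xi):=\xi+Y_e^3(\xi).$$ $\Xi_e$ is strictly increasing and invertible; $z_e^{(0)}(x^0,Z):=x^0-\Xi_e^{-1}(x^0-Z)$ is the zero-density longitudinal trajectory of the electrons initially at $Z$. The lowest-order electron density, for the step-shaped initial density $n_0\theta(Z)$ ($\theta$ the Heaviside step function), is $$n_e^{(0)}(x^0,z):=n_0\,\theta\big[z-Y_e^3(x^0-z)\big]\,\gamma_e^{(0)}(x^0-z).$$ *)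

(* Defs.v *)
From HB Require Import structures.
From mathcomp Require Import all_boot all_order all_algebra.
From mathcomp Require Import all_classical all_reals all_analysis.

Set Implicit Arguments.
Unset Strict Implicit.
Unset Printing Implicit Defensive.

Import Order.TTheory GRing.Theory Num.Theory.
Import numFieldNormedType.Exports.

Local Open Scope classical_set_scope.
Local Open Scope ring_scope.

(* Transverse vectors are row vectors 'rV[R]_2; a point x of the
   (x^0, z)-plane is a pair with x.1 = x^0 and x.2 = z. *)

Definition C2 (R : realType) (f : R -> 'rV[R]_2) : Prop :=
  [/\ forall t : R, derivable f t 1,
      forall t : R, derivable (derive1 f) t 1
    & continuous (derive1n 2 f)].

(* Oriented integral: the minus sign is needed when b < a, because Rintegral
   takes a set as its domain. *)
Definition oint (R : realType) (a b : R) (f : R -> R) : R :=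
  if a <= b then \int[lebesgue_measure]_(t in `[a, b]) f t
  else - \int[lebesgue_measure]_(t in `[b, a]) f t.

Definition ointv (R : realType) (a b : R) (f : R -> 'rV[R]_2) : 'rV[R]_2 :=
  \row_i oint a b (fun t => f t 0 i).

Definition intv2 (R : realType) (D : set (R * R)) (f : R * R -> 'rV[R]_2) :
    'rV[R]_2 :=
  \row_i \int[(lebesgue_measure \x lebesgue_measure)%E]_(p in D) f p 0 i.

(* The value at 0 is a convention. *)
Definition heaviside (R : realType) (s : R) : R := if 0 <= s then 1 else 0.

Definition ue_perp0 (R : realType) (m e c : R) (alpha : R -> 'rV[R]_2) (xi : R) :
    'rV[R]_2 :=
  (e / (m * c ^+ 2)) *: alpha xi.

(* In the definitions below, the argument u stands for the zeroth-order
   transverse field ue_perp0 m e c alpha. *)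

(* The Euclidean norm is spelled out: `|v| on 'rV[R]_2 is the max norm. *)
Definition ue_z0 (R : realType) (u : R -> 'rV[R]_2) (xi : R) : R :=
  2^-1 * \sum_(i < 2) (u xi 0 i) ^+ 2.

Definition gamma_e0 (R : realType) (u : R -> 'rV[R]_2) (xi : R) : R :=
  1 + ue_z0 u xi.

Definition beta_perp0 (R : realType) (u : R -> 'rV[R]_2) (xi : R) : 'rV[R]_2 :=
  (gamma_e0 u xi)^-1 *: u xi.

Definition Ye_perp (R : realType) (u : R -> 'rV[R]_2) (xi : R) : 'rV[R]_2 :=
  ointv 0 xi u.

Definition Ye_3 (R : realType) (u : R -> 'rV[R]_2) (xi : R) : R :=
  oint 0 xi (ue_z0 u).

Definition Xi_e (R : realType) (u : R -> 'rV[R]_2) (xi : R) : R :=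
  xi + Ye_3 u xi.

Definition Xi_e_inv (R : realType) (u : R -> 'rV[R]_2) : R -> R :=
  'pinv_(fun=> 0) [set: R] (Xi_e u).

Definition z_e0 (R : realType) (u : R -> 'rV[R]_2) (x0 Z : R) : R :=
  x0 - Xi_e_inv u (x0 - Z).

Definition n_e0 (R : realType) (n0 : R) (u : R -> 'rV[R]_2) (x0 z : R) : R :=
  n0 * heaviside (z - Ye_3 u (x0 - z)) * gamma_e0 u (x0 - z).

Definition Dcone (R : realType) (x : R * R) : set (R * R) :=
  [set p | 0 <= p.1 <= x.1 /\ `|x.2 - p.2| <= x.1 - p.1].

Definition ue_perp1 (R : realType) (m e c n0 : R) (alpha : R -> 'rV[R]_2)
    (x : R * R) : 'rV[R]_2 :=
  let u := ue_perp0 m e c alpha in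
  u (x.1 - x.2)
  - (2 * pi * e ^+ 2 / (m * c ^+ 2)) *:
    intv2 (Dcone x) (fun p => n_e0 n0 u p.1 p.2 *: beta_perp0 u (p.1 - p.2)).

Definition trajectory0 (R : realType) (u : R -> 'rV[R]_2) : set (R * R) :=
  [set p | exists2 x0, 0 <= x0 & p = (x0, z_e0 u x0 0)].

Definition line_minus (R : realType) (s : R) : set (R * R) :=
  [set p | p.1 + p.2 = s].

(* The intersection point; for 0 <= s the two sets meet in exactly one point,
   and the default (0, 0) only matters outside this range. *)
Definition meet_pt (R : realType) (u : R -> 'rV[R]_2) (s : R) : R * R :=
  xget (0, 0) (line_minus s `&` trajectory0 u).

Definition xi_hat (R : realType) (u : R -> 'rV[R]_2) (xi s : R) : R :=
  Num.min xi ((meet_pt u s).1 - (meet_pt u s).2).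

Definition We_perp (R : realType) (u : R -> 'rV[R]_2) (x : R * R) : 'rV[R]_2 :=
  2^-1 *: ointv 0 (x.1 + x.2) (fun s => Ye_perp u (xi_hat u (x.1 - x.2) s)).

Definition Kconst (R : realType) (m e c n0 : R) : R :=
  pi * e ^+ 2 * n0 / (m * c ^+ 2).

(* Main.v *)
Require Import Defs.
From HB Require Import structures.
From mathcomp Require Import all_boot all_order all_algebra.
From mathcomp Require Import all_classical all_reals all_analysis.
From mathcomp Require Import measurable_realfun ring lra.
Import Order.TTheory GRing.Theory Num.Theory.
Import numFieldNormedType.Exports.
Local Open Scope classical_set_scope.
Local Open Scope ring_scope.

(* The Jacobian factor gamma cancels in n_e * beta, leaving n_0 theta(z - Y^3) u.
   In the coordinates t = x^0 - z, s = x^0 + z the step function becomes the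
   condition h t <= s, where h t = t + 2 Y^3 t, and u vanishes for t <= 0; so
   both sides reduce to the integral over t in [0, xi] of u t times the length
   of {s | h t <= s <= xi_-}, up to constants.  A trajectory point of phase t has
   x^0 + z = 2 Xi t - t = h t, hence the phase of the intersection point
   inverts h and t <= xihat(xi, s) amounts to t <= xi and h t <= s.
   Only Fubini and one-dimensional reflections are used, in place of a change
   of variables in the plane. *)

(** * Invariance of one-dimensional integrals under reflections *)

Lemma measurable_reflection (R : realType) (a : R) :
  measurable_fun [set: measurableTypeR R] ((fun t => a - t) : _ -> measurableTypeR R).
Proof. exact: measurable_funB. Qed.

Lemma lebesgue_measure_reflection (R : realType) (a : R) (A : set R) :
  measurable A ->
  pushforward (@lebesgue_measure R) ((fun t => a - t) : _ -> measurableTypeR R) A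
  = lebesgue_measure A.
Proof.
(* Uniqueness leaves only half-open intervals to check; the reflection moves the closed end to the
   other side and keeps the length. *)
move=> mA; apply/esym/lebesgue_measure_unique => //=.
  exact: measurable_reflection.
move=> ? _ [[b c]] _ <-.
rewrite /pushforward /=.
have -> : ((fun t => a - t) @^-1` `]b, c])%classic = `[a - c, a - b[%classic.
  by apply/seteqP; split => t /=; rewrite !in_itv /=; lra.
rewrite !lebesgue_measure_itv/= !lte_fin -!EFinD.
have -> : (a - c < a - b) = (b < c) by lra.
by case: ifP => // _; congr (_%:E); lra.
Qed.

Lemma ge0_integral_reflection (R : realType) (a : R) (f : R -> \bar R) :
  measurable_fun [set: measurableTypeR R] f -> (forall t, (0 <= f t)%E) ->
  (\int[lebesgue_measure]_t f (a - t)%R = \int[lebesgue_measure]_t f t)%E.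
Proof.
move=> mf f0.
transitivity (\int[pushforward lebesgue_measure
    ((fun t => a - t)%R : _ -> measurableTypeR R)]_t f t)%E.
  rewrite (ge0_integral_pushforward (measurable_reflection R a)) //.
apply: eq_measure_integral; first exact: measurable_reflection.
by move=> ? A mA _; exact: lebesgue_measure_reflection.
Qed.

Lemma integral_reflection (R : realType) (a : R) (f : R -> \bar R) :
  measurable_fun [set: measurableTypeR R] f ->
  (\int[lebesgue_measure]_t f (a - t)%R = \int[lebesgue_measure]_t f t)%E.
Proof.
move=> mf; rewrite integralE [RHS]integralE; congr (_ - _)%E.
- rewrite -(ge0_integral_reflection R a _ (measurable_funepos mf)) //.
  by apply: eq_integral => t _; rewrite !funeposE.
- rewrite -(ge0_integral_reflection R a _ (measurable_funeneg mf)) //.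
  by apply: eq_integral => t _; rewrite !funenegE.
Qed.

(** * Integrability on bounded planar regions and Fubini on strips *)

Lemma integrable_bounded_box (R : realType) (f : R * R -> R) (M a b c d : R) :
  measurable_fun [set: measurableTypeR R * measurableTypeR R] f ->
  (forall p, `|f p| <= M) ->
  (forall p, f p != 0 -> (a <= p.1 <= b) && (c <= p.2 <= d)) ->
  (lebesgue_measure \x lebesgue_measure)%E.-integrable
    [set: measurableTypeR R * measurableTypeR R] (EFin \o f).
Proof.
move=> mf fM fbox.
pose B := (`[a, b]%classic : set (measurableTypeR R)) `*`
  (`[c, d]%classic : set (measurableTypeR R)).
have mB : measurable B by apply: measurableX; exact: measurable_itv.
(* [f] vanishes off the box, so integrability on the plane reduces to that of a bounded function on
   a set of finite measure. *)
have -> : EFin \o f = (EFin \o f) \_ B.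
  apply/funext => p; rewrite patchE; case: ifPn => // /negP pB /=.
  have [->//|/fbox pbox] := eqVneq (f p) 0.
  by exfalso; apply: pB; rewrite inE /B /= !in_itv /=; apply/andP.
apply/integrable_restrict => //; rewrite setTI.
apply: measurable_bounded_integrable => //.
- rewrite [ltLHS]product_measure1E; [|exact: measurable_itv..].
  have finI x y : (@lebesgue_measure R `[x, y]%classic < +oo)%E.
    by rewrite lebesgue_measure_itv /= lte_fin; case: ifPn => _; rewrite ?ltry.
  apply: lte_mul_pinfty => //; last exact: finI.
  by rewrite ge0_fin_numE //; exact: finI.
- exact: measurable_funTS.
- exists M; split; first exact: num_real.
  by move=> N MN p _ /=; apply: le_trans (fM p) (ltW MN).
Qed.

Lemma continuous_itv_bounded (R : realType) (v : R -> R) (a b : R) :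
  continuous v -> exists2 M, 0 <= M & forall t, a <= t <= b -> `|v t| <= M.
Proof.
move=> cv; have [ab|ba] := leP a b; last first.
  exists 0 => // t /andP[at_ tb].
  by have := lt_le_trans ba (le_trans at_ tb); rewrite ltxx.
have cn : continuous (fun t => `|v t|).
  by move=> t; apply: continuous_comp; [exact: cv|exact: norm_continuous].
have [c _ vc] := EVT_max ab (continuous_subspaceT cn).
by exists `|v c| => // t tab; apply: vc; rewrite in_itv.
Qed.

(* The coordinate p.1 is the one integrated over the segment [l t, r t]; p.2 is the
   phase t. *)
Definition strip (R : realType) (v l r : R -> R) (xi : R) (p : R * R) : R :=
  if (0 <= p.2 <= xi) && (l p.2 <= p.1 <= r p.2) then v p.2 else 0.

Lemma measurable_strip (R : realType) (v l r : R -> R) (xi : R) :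
  measurable_fun [set: measurableTypeR R] v ->
  measurable_fun [set: measurableTypeR R] l ->
  measurable_fun [set: measurableTypeR R] r ->
  measurable_fun [set: measurableTypeR R * measurableTypeR R] (strip R v l r xi).
Proof.
move=> mv ml mr.
have m2 (f : R -> R) : measurable_fun [set: measurableTypeR R] f ->
  measurable_fun [set: measurableTypeR R * measurableTypeR R] (fun p => f p.2).
  by move=> mf; apply: measurableT_comp.
apply: measurable_fun_ifT; [|exact: m2|exact: measurable_cst].
by apply: measurable_and; apply: measurable_and; apply: measurable_fun_ler;
  (exact: measurable_cst || exact: measurable_fst || exact: m2 || exact: measurable_snd).
Qed.

Lemma integrable_strip (R : realType) (v l r : R -> R) (xi M : R) :
  continuous v ->
  measurable_fun [set: measurableTypeR R] l ->
  measurable_fun [set: measurableTypeR R] r ->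
  (forall t, 0 <= t <= xi -> 0 <= l t) ->
  (forall t, 0 <= t <= xi -> r t <= M) ->
  (lebesgue_measure \x lebesgue_measure)%E.-integrable
    [set: measurableTypeR R * measurableTypeR R] (EFin \o strip R v l r xi).
Proof.
move=> cv ml mr l0 rM.
have [N N0 vN] := continuous_itv_bounded R v 0 xi cv.
apply: (integrable_bounded_box R _ N 0 M 0 xi).
- by apply: measurable_strip => //; exact: continuous_measurable_fun.
- by move=> p; rewrite /strip; case: ifPn => [/andP[/vN]//|_]; rewrite normr0.
- move=> p; rewrite /strip; case: ifPn => [/andP[p2 /andP[lp pr]] _|_]; last by rewrite eqxx.
  by rewrite p2 (le_trans (l0 _ p2) lp) (le_trans pr (rM _ p2)).
Qed.

(** For fixed [t] the integrand is the constant [v t] on the segment from [l t] to [r t], so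
    exchanging the order leaves [v t] times its length; the [max] with 0 accounts for an empty
    segment. *)
Lemma fubini_strip (R : realType) (v l r : R -> R) (xi M : R) :
  continuous v ->
  measurable_fun [set: measurableTypeR R] l ->
  measurable_fun [set: measurableTypeR R] r ->
  (forall t, 0 <= t <= xi -> 0 <= l t) ->
  (forall t, 0 <= t <= xi -> r t <= M) ->
  (\int[lebesgue_measure]_y \int[lebesgue_measure]_t (strip R v l r xi (y, t))%:E
   = \int[lebesgue_measure]_(t in `[0%R, xi]) (v t * Num.max 0 (r t - l t))%:E)%E.
Proof.
move=> cv ml mr l0 rM.
rewrite (Fubini (integrable_strip R v l r xi M cv ml mr l0 rM)).
rewrite [RHS]integral_mkcond; apply: eq_integral => t _.
rewrite patchE mem_setE /= in_itv /=.
case: ifPn => t0; last first.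
  rewrite integral0_eq // => y _; rewrite /strip /= (negbTE t0) //.
have itvE : lebesgue_measure (`[l t, r t]%classic : set R) = (Num.max 0 (r t - l t))%:E.
  rewrite lebesgue_measure_itv /= lte_fin.
  case: ifPn => lr; first by rewrite -EFinD max_r // subr_ge0 ltW.
  by rewrite max_l // subr_le0 leNgt.
transitivity (\int[lebesgue_measure]_y ((v t)%:E * (\1_(`[l t, r t]%classic : set R) y)%:E))%E.
  apply: eq_integral => y _; rewrite /strip /= t0 /= indicE mem_setE /= in_itv /=.
  by case: ifPn => _; rewrite ?mule1 ?mule0.
rewrite integralZl //; last exact: integrable_indic_itv.
by rewrite integral_indic // setIT EFinM -itvE.
Qed.

(** * Primitives of functions vanishing on the negative half-line *)

Lemma oint_nonpos_eq0 (R : realType) (v : R -> R) (b : R) :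
  (forall t, t <= 0 -> v t = 0) -> b <= 0 -> oint 0 b v = 0.
Proof.
move=> v0; rewrite /oint le_eqVlt => /predU1P[->|b0].
  by rewrite lexx set_itv1 Rintegral_set1.
rewrite leNgt b0 /=; apply/eqP; rewrite oppr_eq0; apply/eqP.
rewrite (@eq_Rintegral _ _ _ _ _ (cst 0)); first by rewrite Rintegral_cst // mul0r.
by move=> t; rewrite inE /= in_itv /= => /andP[_ /v0].
Qed.

Lemma integrable_itv_continuous (R : realType) (v : R -> R) (a b : R) :
  continuous v -> lebesgue_measure.-integrable `[a, b] (EFin \o v).
Proof.
move=> cv; apply: continuous_compact_integrable; first exact: segment_compact.
exact: continuous_subspaceT.
Qed.

Section oint_nonneg.
Context (R : realType) (w : R -> R).
Context (cw : continuous w) (w_ge0 : forall t, 0 <= w t)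
  (w0 : forall t, t <= 0 -> w t = 0).

Let Y (t : R) := oint 0 t w.

Lemma oint_nonneg_ge0 t : 0 <= Y t.
Proof.
have [t0|/ltW t0] := leP 0 t; last by rewrite /Y oint_nonpos_eq0.
by rewrite /Y /oint t0; apply: Rintegral_ge0.
Qed.

Lemma oint_nonneg_homo : {homo Y : s t / s <= t}.
Proof.
move=> s t st; have [s0|/ltW s0] := leP 0 s; last first.
  by rewrite [Y s]oint_nonpos_eq0 // oint_nonneg_ge0.
rewrite /Y /oint s0 (le_trans s0 st) /Rintegral fine_le //.
- exact: integrable_fin_num (integrable_itv_continuous _ _ _ _ cw).
- exact: integrable_fin_num (integrable_itv_continuous _ _ _ _ cw).
- apply: ge0_subset_integral => //=.
  + apply/measurable_EFinP/measurable_funTS; exact: continuous_measurable_fun.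
  + by move=> r _; rewrite lee_fin.
  + by apply: subset_itvl; rewrite bnd_simp.
Qed.

Lemma measurable_oint_nonneg : measurable_fun [set: measurableTypeR R] Y.
Proof. by apply: nondecreasing_measurable => //; exact: oint_nonneg_homo. Qed.

(** The parameter [k] serves two maps: with [w] equal to [ue_z0 u], [k = 1] gives [Xi_e] and [k = 2]
    gives the map h that expresses x^0 + z by the phase. *)
Lemma surjective_add_oint (k s : R) : 0 <= k -> 0 <= s ->
  exists2 t, 0 <= t & t + k * Y t = s.
Proof.
move=> k0 s0.
have Y00 : Y 0 = 0 by rewrite /Y oint_nonpos_eq0.
have cY : {within `[0, s], continuous Y}.
  have := parameterized_integral_continuous s0 (integrable_itv_continuous _ _ 0 s cw).
  apply: subspace_eq_continuous => t; rewrite inE /= in_itv /= => /andP[t0 _].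
  by rewrite /from_subspace /= /Y /oint t0.
(* The map is 0 at 0 and at least [s] at [s], because [Y] is nonnegative. *)
have [||t + <-] := @IVT R (fun t => t + k * Y t) 0 s s s0.
- have cid : {within `[0, s], continuous (fun t : R => t)}.
    by apply: continuous_subspaceT => t; exact: cvg_id.
  move=> t; apply: cvgD; first exact: cid.
  by apply: cvgM; [exact: cvg_cst|exact: cY].
- rewrite Y00 mulr0 addr0 ge_min s0 le_max lerDl mulr_ge0 ?orbT //.
  exact: oint_nonneg_ge0.
- by rewrite in_itv /= => /andP[t0 _]; exists t.
Qed.

(** The identity term makes the sum strictly increasing, since [Y] is nondecreasing. *)
Lemma add_oint_le_mono (k : R) : 0 <= k ->
  {mono (fun t => t + k * Y t) : s t / s <= t}.
Proof.
move=> k0; apply: le_mono => s t st.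
by rewrite ltr_leD // ler_wpM2l // oint_nonneg_homo // ltW.
Qed.

End oint_nonneg.

(** * The integral over the backward cone *)

Section cone.
Context (R : realType) (v Y : R -> R) (x : R * R).
Context (cv : continuous v) (v0 : forall t, t <= 0 -> v t = 0)
  (mY : measurable_fun [set: measurableTypeR R] Y) (Y0 : forall t, 0 <= Y t).

(** One component of the source after gamma has cancelled, up to the factor n_0; [v] stands for a
    component of [u], and [Y] for [Ye_3 u]. *)
Let G (p : R * R) := heaviside (p.2 - Y (p.1 - p.2)) * v (p.1 - p.2).

(* The substitution z = x^0 - t at fixed x^0 turns C into a strip (C_strip). *)
Let C (p : R * R) := if (0 <= p.1 <= x.1) && (`|x.2 - p.2| <= x.1 - p.1) &&
  (0 <= p.2 - Y (p.1 - p.2)) then v (p.1 - p.2) else 0.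

Let restrictG : G \_ (Dcone x) = C.
Proof.
apply/funext => p; rewrite patchE /C /G /heaviside.
case: ifPn => [|/negP pD].
  by rewrite inE => -[-> ->] /=; case: ifPn => _; rewrite ?mul1r ?mul0r.
case: ifPn => // /andP[/andP[p1 p2] _].
by exfalso; apply: pD; rewrite inE.
Qed.

Let measurable_C :
  measurable_fun [set: measurableTypeR R * measurableTypeR R] C.
Proof.
have md : measurable_fun [set: measurableTypeR R * measurableTypeR R]
    (fun p => p.1 - p.2 : measurableTypeR R).
  by apply: measurable_funB; [exact: measurable_fst|exact: measurable_snd].
have mvd : measurable_fun [set: measurableTypeR R * measurableTypeR R]
    (fun p => v (p.1 - p.2)).
  apply: (measurableT_comp _ md); exact: continuous_measurable_fun.
have mYd : measurable_fun [set: measurableTypeR R * measurableTypeR R]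
    (fun p => p.2 - Y (p.1 - p.2)).
  by apply: measurable_funB; [exact: measurable_snd|exact: measurableT_comp].
apply: measurable_fun_ifT => //.
apply: measurable_and; last by apply: measurable_fun_ler.
apply: measurable_and; last first.
  apply: measurable_fun_ler.
    apply: measurableT_comp => //; apply: measurable_funB => //; exact: measurable_snd.
  by apply: measurable_funB => //; exact: measurable_fst.
by apply: measurable_and; apply: measurable_fun_ler => //; exact: measurable_fst.
Qed.

Let integrable_C : (lebesgue_measure \x lebesgue_measure)%E.-integrable
    [set: measurableTypeR R * measurableTypeR R] (EFin \o C).
Proof.
have [M M0 vM] := continuous_itv_bounded R v 0 (x.1 - x.2) cv.
apply: (integrable_bounded_box R _ M 0 x.1 (x.2 - x.1) (x.2 + x.1) measurable_C).
- move=> p; rewrite /C; case: ifPn => [/andP[/andP[p1 p2] _]|_]; last by rewrite normr0.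
  (* On the cone the phase is at most [x.1 - x.2], and [v] vanishes at nonpositive phases, so the
     bound of [v] on a compact interval suffices. *)
  have [d0|/ltW d0] := leP 0 (p.1 - p.2); last by rewrite v0 // normr0.
  apply: vM; rewrite d0 /=; move: p2; rewrite ler_norml; lra.
- move=> p; rewrite /C; case: ifPn => [/andP[/andP[p1 p2] _] _|_]; last by rewrite eqxx.
  by rewrite p1 /=; move: p1 p2; rewrite ler_norml; lra.
Qed.

Lemma measurable_Dcone :
  measurable (Dcone x : set (measurableTypeR R * measurableTypeR R)).
Proof.
pose b (p : R * R) := (0 <= p.1 <= x.1) && (`|x.2 - p.2| <= x.1 - p.1).
have -> : Dcone x = b @^-1` [set true].
  by apply/seteqP; split => p /=; rewrite /b; [case=> -> ->|move/andP].
rewrite -[X in measurable X]setTI.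
suff mb : measurable_fun [set: measurableTypeR R * measurableTypeR R] b by apply: mb.
apply: measurable_and; last first.
  apply: measurable_fun_ler.
    apply: measurableT_comp => //; apply: measurable_funB => //; exact: measurable_snd.
  by apply: measurable_funB => //; exact: measurable_fst.
by apply: measurable_and; apply: measurable_fun_ler => //; exact: measurable_fst.
Qed.

Lemma integrable_cone : (lebesgue_measure \x lebesgue_measure)%E.-integrable
  (Dcone x : set (measurableTypeR R * measurableTypeR R)) (EFin \o G).
Proof.
have := integrable_C; rewrite -restrictG.
rewrite (_ : EFin \o _ = (EFin \o G) \_ (Dcone x)); last first.
  by apply/funext => p /=; rewrite !patchE; case: ifP.
move/integrable_restrict; rewrite setTI; apply => //.
exact: measurable_Dcone.
Qed.

(** With z = y - t, the two cone inequalities read t <= xi and y <= (xi_- + t) / 2, and the step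
    function reads t + Y t <= y. For t > 0 these imply 0 <= y <= x^0; for t <= 0 both sides vanish
    with [v]. *)
Let C_strip y t : 0 <= x.1 ->
  C (y, y - t) = strip R v (fun t => t + Y t) (fun t => (x.1 + x.2 + t) / 2)
    (x.1 - x.2) (y, t).
Proof.
move=> x1; rewrite /C /strip /= subKr.
have [t0|t0] := leP t 0; first by rewrite (v0 _ t0) !if_same.
congr (if _ then _ else _); have := Y0 t.
rewrite ler_norml; lra.
Qed.

Lemma Rintegral_cone : 0 <= x.1 ->
  \int[(lebesgue_measure \x lebesgue_measure)%E]_(p in Dcone x) G p
  = 2^-1 * \int[lebesgue_measure]_(t in `[0, x.1 - x.2])
      (v t * Num.max 0 (x.1 + x.2 - (t + 2 * Y t))).
Proof.
move=> x1.
rewrite Rintegral_mkcond restrictG /Rintegral.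
rewrite -(integral12_prod_meas1 integrable_C) /fubini_F /=.
under eq_integral => y _.
  (* Reflecting z about the fixed time [y] makes the phase t = y - z the inner variable. *)
  rewrite -(integral_reflection R y (fun z => (C (y, z))%:E)); last first.
    by apply/measurable_EFinP; exact: (measurable_fun_pair2 y measurable_C).
  under eq_integral => t _ do rewrite C_strip //.
  over.
have mt : measurable_fun [set: measurableTypeR R] (fun t : R => t) by [].
rewrite (fubini_strip R v _ _ _ x.1) //; first last.
- by move=> t /andP[_ tx]; lra.
- by move=> t /andP[t0 _]; exact: addr_ge0.
- by apply: measurable_funM => //; exact: measurable_funD.
- exact: measurable_funD.
pose F t := v t * Num.max 0 (x.1 + x.2 - (t + 2 * Y t)).
have intF : lebesgue_measure.-integrable `[0, x.1 - x.2] (EFin \o F).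
  have [M M0 vM] := continuous_itv_bounded R v 0 (x.1 - x.2) cv.
  apply: measurable_bounded_integrable => //.
  + rewrite /= lebesgue_measure_itv /= lte_fin; case: ifPn => _; rewrite ?ltry //.
  + apply: measurable_funTS; apply: measurable_funM; first exact: continuous_measurable_fun.
    apply: measurable_maxr => //; apply: measurable_funB => //.
    by apply: measurable_funD => //; exact: measurable_funM.
  (* For t >= 0 the subtracted term t + 2 Y t is nonnegative, so the [max] is at most
     [|x.1 + x.2|]. *)
  + exists (M * `|x.1 + x.2|); split; first exact: num_real.
    move=> N MN t /=; rewrite in_itv /= => t0; apply: le_trans (ltW MN).
    rewrite normrM ler_pM // ?vM //.
    rewrite ger0_norm ?le_max ?lexx // ge_max normr_ge0 /=.
    apply: le_trans (ler_norm _); move: t0 => /andP[t0 _].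
    have := Y0 t; lra.
(* The strip has length (xi_- + t) / 2 - (t + Y t), half of xi_- - (t + 2 Y t); this 1/2 is the
   Jacobian of the coordinates (t, s). *)
rewrite -RintegralZl // -[LHS]/(Rintegral _ _ _); apply: eq_Rintegral => t _.
rewrite mulrCA; congr (_ * _); rewrite maxr_pMr ?invr_ge0 // mulr0; congr Num.max.
lra.
Qed.
End cone.

(** * The integral defining W as an integral over a strip *)

Lemma Rintegral_oint_min (R : realType) (v g h : R -> R) (xi s : R) :
  continuous v -> (forall t, t <= 0 -> v t = 0) ->
  {mono h : t t' / t <= t'} -> (forall t, 0 <= t -> 0 <= h t) ->
  (forall t, 0 <= t -> h (g t) = t) -> 0 <= s ->
  oint 0 s (fun t => oint 0 (Num.min xi (g t)) v)
  = \int[lebesgue_measure]_(t in `[0, xi]) (v t * Num.max 0 (s - h t)).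
Proof.
move=> cv v0 hm h0 hg s0.
have mh : measurable_fun [set: measurableTypeR R] h.
  by apply: nondecreasing_measurable => // t t'; rewrite hm.
rewrite {1}/oint s0 Rintegral_mkcond /Rintegral.
rewrite -(fubini_strip R v h (cst s) xi s) //; last by move=> t /andP[/h0].
congr fine; apply: eq_integral => y _.
rewrite patchE mem_setE /= in_itv /=; case: ifPn => [/andP[y0 ys]|ys]; last first.
  rewrite integral0_eq // => t _; rewrite /strip /=; case: ifPn => //.
  move=> /andP[/andP[t0 _] /andP[hy ys']].
  by exfalso; move: ys; rewrite ys' (le_trans (h0 _ t0) hy).
(* As [h] is increasing and [h (g y) = y], the condition [h t <= y] means [t <= g y], so the section
   of the strip at [y] is the interval from 0 to [Num.min xi (g y)]. *)
transitivity (\int[lebesgue_measure]_(t in `[0%R, Num.min xi (g y)]) (v t)%:E)%E; last first.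
  rewrite [LHS]integral_mkcond; apply: eq_integral => t _.
  rewrite patchE mem_setE /strip /= in_itv /= le_min.
  have -> : (h t <= y) = (t <= g y) by rewrite -{1}(hg _ y0) hm.
  by rewrite ys andbT andbA; case: ifP.
have [m0|m0] := leP 0 (Num.min xi (g y)).
  rewrite /oint m0 /Rintegral fineK //.
  exact: integrable_fin_num (integrable_itv_continuous _ _ _ _ cv).
(* With a negative upper end, as for xi < 0, the oriented integral is 0 because [v] vanishes there,
   and the other integral runs over an empty interval. *)
rewrite (oint_nonpos_eq0 _ _ _ v0 (ltW m0)) set_itv_ge ?integral_set0 //.
by rewrite bnd_simp -ltNge.
Qed.

(** * The phase of the point where the line meets the trajectory *)

Section trajectory.
Context (R : realType) (u : R -> 'rV[R]_2).
Context (cu : forall i, continuous (fun t => u t 0 i))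
  (u0 : forall t, t <= 0 -> u t = 0).

Lemma continuous_ue_z0 : continuous (ue_z0 u).
Proof.
have cu2 i : continuous (fun t => u t 0 i ^+ 2).
  move=> t; apply: (@continuous_comp _ _ _ (fun t => u t 0 i) (fun y => y ^+ 2)).
    exact: cu.
  exact: exprn_continuous.
have -> : ue_z0 u = fun t => 2^-1 * (u t 0 ord0 ^+ 2 + u t 0 (lift ord0 ord0) ^+ 2).
  by apply/funext => t; rewrite /ue_z0 !big_ord_recl big_ord0 addr0.
move=> t; apply: cvgM; first exact: cvg_cst.
by apply: cvgD; exact: cu2.
Qed.

Lemma ue_z0_ge0 t : 0 <= ue_z0 u t.
Proof. by rewrite mulr_ge0 // sumr_ge0 // => i _; exact: sqr_ge0. Qed.

Lemma ue_z0_eq0 t : t <= 0 -> ue_z0 u t = 0.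
Proof. by move=> t0; rewrite /ue_z0 big1 ?mulr0 // => i _; rewrite u0 // mxE expr0n. Qed.

Lemma Xi_e_le_mono : {mono Xi_e u : s t / s <= t}.
Proof.
move=> s t.
have := add_oint_le_mono R _ continuous_ue_z0 ue_z0_ge0 ue_z0_eq0 1 ler01 s t.
by rewrite !mul1r.
Qed.

Lemma Xi_eK : cancel (Xi_e u) (Xi_e_inv u).
Proof.
move=> t; apply: pinvKV; last by rewrite inE.
by move=> s s' _ _; exact: (inc_inj Xi_e_le_mono).
Qed.

Lemma meet_ptP s : 0 <= s ->
  let t := (meet_pt u s).1 - (meet_pt u s).2 in t + 2 * Ye_3 u t = s.
Proof.
move=> s0 /=.
have XiE t : t + 2 * Ye_3 u t = 2 * Xi_e u t - t by rewrite /Xi_e; lra.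
have ex : exists p, (line_minus s `&` trajectory0 u) p.
  (* Solving t + 2 Y t = s gives the phase of an intersection point, reached at time [Xi_e u t]. *)
  have [t t0 tE] := surjective_add_oint R _ continuous_ue_z0 ue_z0_ge0 ue_z0_eq0
    2 s (ler0n _ _) s0.
  exists (Xi_e u t, z_e0 u (Xi_e u t) 0); split.
    by rewrite /line_minus /= /z_e0 subr0 Xi_eK -tE /Xi_e /Ye_3; lra.
  exists (Xi_e u t) => //; rewrite addr_ge0 //.
  exact: (oint_nonneg_ge0 R _ ue_z0_ge0 ue_z0_eq0).
(* Existence excludes the default of [xget]: [meet_pt u s] lies on both the line and the
   trajectory. *)
have [] := xgetPex (0, 0) ex; rewrite -/(meet_pt u s) => sE [x0 x00 pE].
move: sE; rewrite pE /line_minus /= /z_e0 subr0.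
(* Its time [x0] is written as [Xi_e u t], which makes its phase [t]. *)
have [t _] := surjective_add_oint R _ continuous_ue_z0 ue_z0_ge0 ue_z0_eq0
  1 x0 ler01 x00.
by rewrite mul1r -/(Ye_3 u t) -/(Xi_e u t) => <-; rewrite Xi_eK XiE subKr; lra.
Qed.

End trajectory.

(** * Assembly, one component at a time *)

Lemma derivable_coord_continuous (R : realType) (f : R -> 'rV[R]_2) i :
  (forall t, derivable f t 1) -> continuous (fun t => f t 0 i).
Proof.
move=> df t; apply: (@continuous_comp _ _ _ f (fun y => y 0 i)).
  by apply: differentiable_continuous; apply/derivable1_diffP; exact: df.
exact: coord_continuous.
Qed.

Theorem mainTheorem6 (R : realType) (m e c n0 : R) (alpha : R -> 'rV[R]_2)
    (m_gt0 : 0 < m) (c_gt0 : 0 < c) (n0_ge0 : 0 <= n0)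
    (alphaC2 : C2 alpha) (alpha0 : forall xi : R, xi <= 0 -> alpha xi = 0)
    (x : R * R) (x0_ge0 : 0 <= x.1) (xim_ge0 : 0 <= x.1 + x.2) :
  ue_perp1 m e c n0 alpha x - ue_perp0 m e c alpha (x.1 - x.2)
  = (- 2 * Kconst m e c n0) *: We_perp (ue_perp0 m e c alpha) x.
Proof.
have [dalpha _ _] := alphaC2.
rewrite /ue_perp1 addrAC subrr add0r; set u := ue_perp0 m e c alpha.
have u0 t : t <= 0 -> u t = 0 by move=> t0; rewrite /u /ue_perp0 alpha0 // scaler0.
have cu i : continuous (fun t => u t 0 i).
  have -> : (fun t => u t 0 i) = (fun t => (e / (m * c ^+ 2)) * alpha t 0 i).
    by apply/funext => t; rewrite mxE.
  move=> t; apply: cvgM; first exact: cvg_cst.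
  exact: derivable_coord_continuous.
have cw := continuous_ue_z0 R u cu; have w_ge0 := ue_z0_ge0 R u.
have w0 := ue_z0_eq0 R u u0.
have Y_ge0 : forall t, 0 <= Ye_3 u t := oint_nonneg_ge0 R _ w_ge0 w0.
apply/rowP => i; rewrite !mxE.
have v0 t : t <= 0 -> u t 0 i = 0 by move=> /u0 ->; rewrite mxE.
have mY := measurable_oint_nonneg R _ cw w_ge0 w0.
have intG := integrable_cone R _ _ x (cu i) v0 mY.
(* gamma is at least 1, so it cancels against the denominator of beta, and n_0 leaves the
   integral. *)
transitivity (- (2 * pi * e ^+ 2 / (m * c ^+ 2) * (n0 *
  \int[(lebesgue_measure \x lebesgue_measure)%E]_(p in Dcone x)
     (heaviside (p.2 - Ye_3 u (p.1 - p.2)) * u (p.1 - p.2) 0 i)))).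
  congr (- (_ * _)); rewrite -RintegralZl //; last exact: measurable_Dcone.
  apply: eq_Rintegral => p _; rewrite !mxE /n_e0.
  have : gamma_e0 u (p.1 - p.2) != 0 by rewrite lt0r_neq0 // ltr_wpDr.
  by move=> g0; rewrite -mulrA mulVKf // -mulrA.
rewrite (Rintegral_cone R _ _ x (cu i) v0 mY Y_ge0 x0_ge0).
(* The inverse of h is the phase of the intersection point, by [meet_ptP]. *)
rewrite -(Rintegral_oint_min R _ (fun s => (meet_pt u s).1 - (meet_pt u s).2)
  (fun t => t + 2 * Ye_3 u t)) //; first last.
- by move=> t t0; exact: meet_ptP.
- by move=> t t0; rewrite addr_ge0 // mulr_ge0.
- by move=> s t; exact: (add_oint_le_mono R _ cw w_ge0 w0 2 (ler0n _ _)).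
under [in RHS]eq_fun do rewrite mxE.
(* The 1/2 from the cone integral matches the 1/2 in the definition of W. *)
rewrite /Kconst /xi_hat; field.
by rewrite !lt0r_neq0.
Qed.
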